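(* Every subgroup $H$ of a finite abelian group $G$ is a perfect code of some Cayley sum graph $\mathrm{CS}(G,X)$ of $G$.
   Context: For a normal subset $X$ of a finite group $G$ (i.e. $g^{-1}Xg=X$ for all $g\in G$), the Cayley sum graph $\mathrm{CS}(G,X)$ is the simple graph with vertex set $G$ in which distinct vertices $g,h$ are adjacent iff $gh\in X$. A perfect code in a graph is an independent set $C$ of vertices such that every vertex outside $C$ has exactly one neighbour in $C$. *)

(* Defs.v *)
From mathcomp Require Import all_boot all_fingroup.

Set Implicit Arguments.
Unset Strict Implicit.
Unset Printing Implicit Defensive.

Local Open Scope group_scope.

(* A graph on a finite vertex set V is given by its adjacency relation e,
   which is only inspected on V. *)
Definition independent (T : finType) (e : rel T) (C : {set T}) : Prop :=
  {in C &, forall x y, ~~ e x y}.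

Definition perfect_code (T : finType) (V : {set T}) (e : rel T)
    (C : {set T}) : Prop :=
  [/\ C \subset V,
      independent e C
    & {in V :\: C, forall v, #|[set c in C | e v c]| = 1%N}].

Definition cayley_sum (gT : finGroupType) (G X : {set gT}) : rel gT :=
  fun g h => [&& g \in G, h \in G, g != h & g * h \in X].

Lemma cayley_sum_irr (gT : finGroupType) (G X : {set gT}) :
  irreflexive (cayley_sum G X).
Proof. by move=> g; rewrite /cayley_sum eqxx !andbF. Qed.

(* Here X <| G says that X is a subset of G stable under conjugation by G;
   X need not be a subgroup. *)
Lemma cayley_sum_sym (gT : finGroupType) (G X : {set gT}) :
  X <| G -> symmetric (cayley_sum G X).
Proof.
case/andP=> _ /subsetP nXG g h; rewrite /cayley_sum [h == g]eq_sym andbCA.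
case Gh: (h \in G) => //=; case Gg: (g \in G) => //=.
by rewrite -(memJ_norm (g * h) (nXG _ Gg)) conjgE mulgA mulKg.
Qed.

(* Main.v *)
Require Import Defs.
From mathcomp Require Import all_boot all_fingroup.

Set Implicit Arguments.
Unset Strict Implicit.
Unset Printing Implicit Defensive.

Local Open Scope group_scope.

(* Take X to be a transversal of the cosets of H other than H itself. As v ranges
   over G \ H and h over H, v * h runs over the coset v H, which meets X in exactly
   one point, while products of two elements of H never lie in X. *)

Theorem theorem5p1 (gT : finGroupType) (G H : {group gT}) :
  abelian G -> H \subset G ->
  exists X : {set gT}, X <| G /\ perfect_code G (cayley_sum G X) H.
Proof.
(* [repr] chooses one point in each coset, so the test keeps [x] exactly when it is the chosen point
   of its own coset. *)
move=> cGG sHG; pose X := [set x in G :\: H | repr (x *: H) == x].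
have sXG : X \subset G by apply/subsetP=> x; rewrite !inE => /andP[/andP[]].
exists X; split; first by rewrite /normal sXG (sub_abelian_norm cGG sXG).
split=> // [h k Hh Hk | v /setDP[Gv H'v]].
  by rewrite /cayley_sum !inE groupM ?andbF.
(* The chosen point of [v *: H] is [v * h0]; this [h0] will be the only neighbour of [v] in [H]. *)
have /lcosetP[h0 Hh0 def_r]: repr (v *: H) \in v *: H.
  exact: mem_repr (lcoset_refl H v).
rewrite -(cards1 h0); congr #|pred_of_set _|; apply/setP=> h.
rewrite !inE /cayley_sum Gv /=.
case Hh: (h \in H) => /=; last by apply/esym; apply: contraFF Hh => /eqP->.
have Gh := subsetP sHG _ Hh.
have neq_vh : v != h by apply: contraNneq H'v => ->.
rewrite Gh neq_vh !inE groupMr // H'v groupM //=.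
(* As [h] lies in [H], [v * h] and [v] share a coset, so the test becomes [v * h0 == v * h] and [v]
   cancels. *)
by rewrite lcosetM lcoset_id // def_r (inj_eq (mulgI v)) eq_sym.
Qed.
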